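(* Let $A$, $B$ and $Z$ be generators of $lC_0$-semigroups in a sequentially complete (Hausdorff) locally convex space $\mathbf{X}$ and let $D$ be a core of the generator $Z$. Suppose that $D\subset\mathcal{D}(A)\cap\mathcal{D}(B)$, that $Zf=Af+Bf$ for all $f\in D$, and that the function $[0,\infty)\ni s\mapsto\exp(sA)\exp(sB)$ belongs to $\mathcal{E}_{\mathbf{X}}$. Then for all $f\in\mathbf{X}$, $\left(\exp(\tfrac tnA)\exp(\tfrac tnB)\right)^nf$ tends to $\exp(tZ)f$ as $n\to\infty$ uniformly with respect to $t\in[0,t_0]$ for any $t_0>0$.
   Context: $\mathbf{X}$ is over $\mathbb{T}\in\{\mathbb{R},\mathbb{C}\}$ with topology generated by semi-norms $\|\cdot\|_\alpha$, $\alpha\in\Omega$. $\mathcal{L}(\mathbf{X})$ is the space of bounded linear operators in $\mathbf{X}$ with the topology of pointwise convergence; $I$ is the identity; $\mathcal{D}(C)$ is the domain of $C$. A family $G_\beta\in\mathcal{L}(\mathbf{X})$, $\beta\in\Gamma$, is equicontinuous if for any $\alpha\in\Omega$ there are finitely many $\alpha_1,\dots,\alpha_n\in\Omega$ and $b_1,\dots,b_n>0$ with $\sup_\beta\|G_\beta x\|_\alpha\le\sum_i b_i\|x\|_{\alpha_i}$ for all $x\in\mathbf{X}$. For $F:[0,\infty)\to\mathcal{L}(\mathbf{X})$ and $s\ge0$ put $\mathbf{B}^F_s=\{F(\tfrac dn)^m : md/n\le s,\ n,m\in\mathbb{N},\ d\ge0\}$. $\mathcal{E}_{\mathbf{X}}$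 is the set of $F:[0,\infty)\to\mathcal{L}(\mathbf{X})$ with $F(0)=I$ and $\mathbf{B}^F_s$ equicontinuous for every $s\ge0$. An $lC_0$-semigroup is a continuous function $T:[0,\infty)\to\mathcal{L}(\mathbf{X})$ with $T(0)=I$, $T(l+m)=T(l)T(m)$ for $l,m\ge0$, and $T\in\mathcal{E}_{\mathbf{X}}$. Its generator is the operator $Z\psi=\lim_{h\to0}h^{-1}(T(h)\psi-\psi)$ with domain the set of all $\psi$ for which the limit exists; one writes $T(t)=\exp(tZ)$ (a generator determines its semigroup). A set $D\subset\mathcal{D}(Z)$ is a core of the generator $Z$ if the closure of $\{(x,Zx):x\in D\}$ in $\mathbf{X}\times\mathbf{X}$ equals the graph of $Z$. *)

(* Defs.v *)
From HB Require Import structures.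
From mathcomp Require Import all_boot all_order all_algebra.
From mathcomp Require Import all_classical all_reals all_analysis.
From mathcomp Require Import complex.

Set Implicit Arguments.
Unset Strict Implicit.
Unset Printing Implicit Defensive.

Import Order.TTheory GRing.Theory Num.Theory.
Import numFieldNormedType.Exports.

Local Open Scope classical_set_scope.
Local Open Scope ring_scope.
Local Open Scope complex_scope.

Inductive scalar_kind := RealScalars | ComplexScalars.

Definition scalars (R : realType) (k : scalar_kind) : numFieldType :=
  match k with RealScalars => R | ComplexScalars => R[i] end.

Definition of_real (R : realType) (k : scalar_kind) : R -> scalars R k :=
  match k with RealScalars => fun t => t | ComplexScalars => fun t => t%:C end.

Section LocallyConvex.
Context (R : realType) (k : scalar_kind).
Local Notation K := (scalars R k).
Context (X : tvsType K) (Omega : Type).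
Implicit Types (p : Omega -> X -> K) (D : set X).

(* As for norms in the library, seminorms take values in the nonnegative
   elements of the scalar field; in [R[i]] these are the nonnegative reals. *)
Definition is_seminorm (q : X -> K) :=
  [/\ forall x, 0 <= q x,
      forall x y, q (x + y) <= q x + q y
    & forall (a : K) x, q (a *: x) = `|a| * q x].

Definition generating_seminorms p :=
  (forall a, is_seminorm (p a)) /\
  forall (x : X) (V : set X), nbhs x V <->
    exists (n : nat) (a : 'I_n -> Omega) (e : K),
      0 < e /\ [set y | forall i, p (a i) (y - x) < e] `<=` V.

(* The uniform structure carried by a [tvsType] need not be
   translation-invariant, so that the library's [cauchy] and uniform
   convergence are not the vector space notions: Cauchy sequences and uniform
   convergence are expressed with the seminorms. *)
Definition seminorm_cauchy p (u : nat -> X) :=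
  forall a (e : K), 0 < e ->
    exists N : nat, forall m n : nat,
      (N <= m)%N -> (N <= n)%N -> p a (u m - u n) < e.

Definition sequentially_complete p :=
  forall u : nat -> X, seminorm_cauchy p u -> exists l : X, u @ \oo --> l.

Definition uniform_cvg_on p (S : set R) (u : nat -> R -> X) (g : R -> X) :=
  forall a (e : K), 0 < e ->
    exists N : nat, forall n : nat, (N <= n)%N ->
      forall t, S t -> p a (u n t - g t) < e.

Definition equicontinuous_family p (G : set (X -> X)) :=
  forall a, exists (n : nat) (c : 'I_n -> Omega) (b : 'I_n -> K),
    (forall i, 0 < b i) /\
    forall g, G g -> forall x, p a (g x) <= \sum_(i < n) b i * p (c i) x.

(* Boundedness of a linear operator is the seminorm estimate, that is,
   equicontinuity of the one-element family. *)
Definition bounded_operators p : set (X -> X) :=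
  [set g | linear g /\ equicontinuous_family p [set g]].

(* Functions on [0, oo) are represented by functions on R of which only the
   values at nonnegative arguments are ever used. *)
Definition power_family (F : R -> X -> X) (s : R) : set (X -> X) :=
  [set g | exists (n m : nat) (d : R),
     [/\ (0 < n)%N, (0 < m)%N, 0 <= d, m%:R * d / n%:R <= s
       & g = iter m (F (d / n%:R))]].

Definition EX p : set (R -> X -> X) :=
  [set F | [/\ forall t, 0 <= t -> bounded_operators p (F t),
               F 0 = id
             & forall s, 0 <= s -> equicontinuous_family p (power_family F s)]].

Definition lC0_semigroup p (T : R -> X -> X) :=
  [/\ {within `[0, +oo[, continuous (T : R -> {ptws X -> X})},
      T 0 = id,
      forall l m, 0 <= l -> 0 <= m -> T (l + m) = T l \o T m
    & EX p T].

(* An operator in X; the values of [act] outside [dom] are irrelevant. *)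
Record operator := Operator { dom : set X; act :> X -> X }.

Definition graph (C : operator) : set (X * X) :=
  [set (x, C x) | x in dom C].

Definition difference_quotient (T : R -> X -> X) (x : X) (h : R) : X :=
  of_real k h^-1 *: (T h x - x).

Definition is_generator (T : R -> X -> X) (C : operator) :=
  dom C = [set x | exists y : X, difference_quotient T x @ 0^'+ --> y] /\
  forall x, dom C x -> difference_quotient T x @ 0^'+ --> C x.

Definition generates p (T : R -> X -> X) (C : operator) :=
  lC0_semigroup p T /\ is_generator T C.

Definition core (C : operator) D :=
  D `<=` dom C /\ closure [set (x, C x) | x in D] = graph C.

End LocallyConvex.

(* Main.v *)
Require Import Defs.
From HB Require Import structures.
From mathcomp Require Import all_boot all_order all_algebra.
From mathcomp Require Import all_classical all_reals all_analysis.
From mathcomp Require Import complex lra ring zify.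

Set Implicit Arguments.
Unset Strict Implicit.
Unset Printing Implicit Defensive.

Import Order.TTheory GRing.Theory Num.Theory.
Import numFieldNormedType.Exports.

Local Open Scope classical_set_scope.
Local Open Scope ring_scope.

(* The seminorms are replaced by the directed family P of their finite
   nonnegative real combinations, so that equicontinuity bounds one seminorm by
   another one.  It suffices to treat f in the domain of Z, which is dense: by
   sequential completeness the averages of s |-> exp(sZ) x over [0, t] converge
   to points of the domain.

   Local equicontinuity gives no bound on all the powers of F(h) =
   exp(hA) exp(hB), so neither resolvents nor exp(t (F(h) - I) / h) are
   available.  Instead, fix a small mesh tau, choose points d_i of the core with
   (d_i, Z d_i) close to (exp(i tau Z) f, Z exp(i tau Z) f), and interpolate
   linearly.  With v(s) the resulting broken line, v' is uniformly close to Z v,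
   and since v lives in the span of finitely many points of D,
   F(h) v(jh) - v((j+1)h) is at most a small multiple of h, uniformly in j.
   The identity F^n v_0 - v_n = sum_j F^(n-1-j) (F v_j - v_(j+1)) and
   the equicontinuity of the powers F(h)^j with jh <= t_0 then keep F(h)^n v_0
   close to v_n, hence to exp(nhZ) f. *)

(** * Real seminorms and broken lines *)

Section LinearMaps.
Context {R : pzRingType} {U V : lmodType R} (f : U -> V) (lin_f : linear f).

Let g : {linear U -> V} := HB.pack f (GRing.isLinear.Build R U V *:%R f lin_f).

Lemma linD x y : f (x + y) = f x + f y. Proof. exact: (linearD g). Qed.

Lemma linB x y : f (x - y) = f x - f y. Proof. exact: (linearB g). Qed.

Lemma linZ a x : f (a *: x) = a *: f x. Proof. exact: (linearZ_LR g). Qed.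

Lemma lin_sum I (r : seq I) (F : I -> U) :
  f (\sum_(i <- r) F i) = \sum_(i <- r) f (F i).
Proof. exact: (linear_sum g). Qed.

End LinearMaps.

Lemma linear_iter (R : pzRingType) (V : lmodType R) (f : V -> V) n :
  linear f -> linear (iter n f).
Proof. by move=> lin_f; elim: n => // n IH a x y; rewrite !iterS IH lin_f. Qed.

Section RealSeminorms.
Context {R : realType} {V : lmodType R}.
Implicit Types (Q : V -> R) (x y z : V).

Definition seminorm Q :=
  (forall x y, Q (x + y) <= Q x + Q y) /\
  (forall c x, Q (c *: x) = `|c| * Q x).

Section OneSeminorm.
Context Q (sQ : seminorm Q).

Lemma seminormD x y : Q (x + y) <= Q x + Q y. Proof. exact: sQ.1. Qed.

Lemma seminormZ c x : Q (c *: x) = `|c| * Q x. Proof. exact: sQ.2. Qed.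

Lemma seminormZ_ge0 c x : 0 <= c -> Q (c *: x) = c * Q x.
Proof. by move=> c0; rewrite seminormZ ger0_norm. Qed.

Lemma seminorm0 : Q 0 = 0.
Proof. by rewrite -(scale0r (0 : V)) seminormZ normr0 mul0r. Qed.

Lemma seminormN x : Q (- x) = Q x.
Proof. by rewrite -scaleN1r seminormZ normrN1 mul1r. Qed.

Lemma seminorm_distC x y : Q (x - y) = Q (y - x).
Proof. by rewrite -seminormN opprB. Qed.

Lemma seminorm_dist x y z : Q (x - z) <= Q (x - y) + Q (y - z).
Proof. by apply: le_trans (seminormD _ _); rewrite addrA subrK. Qed.

Lemma seminorm_ge0 x : 0 <= Q x.
Proof.
have := seminormD x (- x); rewrite subrr seminorm0 seminormN.
by rewrite -mulr2n pmulrn_lge0.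
Qed.

Lemma seminorm_sum n (F : nat -> V) :
  Q (\sum_(0 <= i < n) F i) <= \sum_(0 <= i < n) Q (F i).
Proof.
elim: n => [|n IH]; first by rewrite !big_nil seminorm0.
by rewrite !big_nat_recr//=; apply: le_trans (seminormD _ _) _; rewrite lerD2r.
Qed.

Lemma seminorm_sum_le n (F : nat -> V) e :
  (forall i, (i < n)%N -> Q (F i) <= e) ->
  Q (\sum_(0 <= i < n) F i) <= n%:R * e.
Proof.
move=> Fe; apply: le_trans (seminorm_sum _ _) _.
apply: (@le_trans _ _ (\sum_(0 <= i < n) e)).
  by rewrite !big_mkord; apply: ler_sum => i _; exact: Fe.
by rewrite big_const_nat subn0 iter_addr addr0 mulr_natl.
Qed.

Lemma seminorm_avg_le n (F : nat -> V) e : (0 < n)%N ->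
  (forall i, (i < n)%N -> Q (F i) <= e) ->
  Q (n%:R^-1 *: \sum_(0 <= i < n) F i) <= e.
Proof.
move=> n0 /seminorm_sum_le Fe; rewrite seminormZ_ge0 ?invr_ge0//.
by rewrite ler_pdivrMl ?ltr0n.
Qed.

Lemma seminorm_convex (t : R) x y e : 0 <= t <= 1 -> Q x <= e -> Q y <= e ->
  Q ((1 - t) *: x + t *: y) <= e.
Proof.
move=> /andP[t0 t1] xe ye; apply: le_trans (seminormD _ _) _.
rewrite !seminormZ_ge0 ?subr_ge0//.
have : (1 - t) * Q x <= (1 - t) * e by rewrite ler_wpM2l// subr_ge0.
have : t * Q y <= t * e by rewrite ler_wpM2l.
lra.
Qed.

End OneSeminorm.

(** Telescoping: trading [v k] followed by [n - k] iterations for [v k.+1] followed by one fewer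
    costs [iter (n - k.+1) f] applied to the one-step defect, and these powers are bounded from [Q']
    to [Q]. *)
Lemma seminorm_iter_drift Q Q' (f : V -> V) (v : nat -> V) n (c : R) :
  seminorm Q -> linear f ->
  (forall k x, (k <= n)%N -> Q (iter k f x) <= Q' x) ->
  (forall j, (j < n)%N -> Q' (f (v j) - v j.+1) <= c) ->
  Q (iter n f (v 0%N) - v n) <= n%:R * c.
Proof.
move=> sQ lin_f fQ vc.
suff H k : (k <= n)%N ->
    Q (iter n f (v 0%N) - iter (n - k) f (v k)) <= k%:R * c.
  by have := H n (leqnn n); rewrite subnn.
elim: k => [_|k IH kn]; first by rewrite subn0 subrr seminorm0// mul0r.
apply: le_trans (seminorm_dist sQ _ (iter (n - k) f (v k)) _) _.
rewrite mulrSr mulrDl mul1r lerD// ?IH// 1?ltnW//.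
have -> : (n - k = (n - k.+1).+1)%N by lia.
rewrite iterSr -(linB (linear_iter _ lin_f)).
by apply: (le_trans (fQ _ _ _) (vc _ kn)); lia.
Qed.

End RealSeminorms.

(** Piecewise linear interpolation of the nodes [d i] with [m] substeps per segment: the quotient of
    [j] by [m] selects the segment, the remainder the position in it. *)
Definition broken_line {R : realType} {V : lmodType R} (d : nat -> V) m j : V :=
  (1 - (j %% m)%:R / m%:R) *: d (j %/ m)%N +
  ((j %% m)%:R / m%:R) *: d (j %/ m).+1.

Lemma broken_lineS {R : realType} {V : lmodType R} (d : nat -> V) m j :
  (0 < m)%N ->
  broken_line d m j.+1 =
    broken_line d m j + m%:R^-1 *: (d (j %/ m).+1 - d (j %/ m)%N).
Proof.
move=> m0; rewrite /broken_line.
have m_neq0 : m%:R != 0 :> R by rewrite pnatr_eq0; lia.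
set i := (j %/ m)%N; set r := (j %% m)%N.
have jE : j = (i * m + r)%N by rewrite -divn_eq.
have rm : (r < m)%N by rewrite ltn_mod.
have -> : (1 - r%:R / m%:R) *: d i + (r%:R / m%:R) *: d i.+1 +
    m%:R^-1 *: (d i.+1 - d i) =
  (1 - r.+1%:R / m%:R) *: d i + (r.+1%:R / m%:R) *: d i.+1.
  rewrite scalerBr [X in _ + X]addrC addrACA -scaleNr -!scalerDl.
  by congr (_ *: _ + _ *: _); rewrite -natr1; field.
have [r1m|] := ltnP r.+1 m.
  have -> : (j.+1 %/ m = i)%N by rewrite jE -addnS divnMDl// divn_small// addn0.
  by have -> : (j.+1 %% m = r.+1)%N by rewrite jE -addnS modnMDl modn_small.
(* This substep completes a segment: [j.+1] is encoded as the start of the next one, with remainder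
   0. *)
move=> mr; have rE : r.+1 = m by lia.
have -> : (j.+1 %/ m = i.+1)%N by rewrite jE -addnS rE divnMDl// divnn m0 addn1.
have -> : (j.+1 %% m = 0)%N by rewrite jE -addnS rE modnMDl modnn.
by rewrite rE divff// subrr mul0r subr0 !scale0r !scale1r addr0 add0r.
Qed.

(** The filter [0^'+] says nothing about the point 0, which is therefore supplied separately;
    halving [t] makes the interval closed. *)
Lemma near0_itv {R : realType} (A : R -> Prop) :
  (\forall h \near 0^'+, A h) -> A 0 ->
  exists2 t, 0 < t & forall h, 0 <= h -> h <= t -> A h.
Proof.
move=> [t /= t0 At] A0; exists (t / 2); first by rewrite divr_gt0.
move=> h; rewrite le_eqVlt => /orP[/eqP <-//|h0] ht; apply: At => //=.
rewrite sub0r normrN gtr0_norm//; lra.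
Qed.

Lemma near0_truncn {R : realType} (tau C : R) : 0 < tau ->
  \forall h \near 0^'+, C <= (Num.truncn (tau / h))%:R.
Proof.
move=> tau0; have C0 : 0 < `|C| + 1 by rewrite ltr_pwDr.
near=> h.
have h0 : 0 < h by near: h; exact: nbhs_right_gt.
have hC : h <= tau / (`|C| + 1).
  by near: h; apply: nbhs_right_le; rewrite divr_gt0.
have /andP[_] := @truncn_itv R (tau / h) (divr_ge0 (ltW tau0) (ltW h0)).
rewrite -natr1 => lt_tr.
have : `|C| + 1 <= tau / h.
  by rewrite ler_pdivlMr// mulrC -ler_pdivlMr.
have := ler_norm C; lra.
Unshelve. all: by end_near. Qed.

Lemma near_inv_nat {R : realType} (c e : R) : 0 < e -> exists n0 : nat,
  (0 < n0)%N /\ forall n : nat, (n0 <= n)%N -> c / n%:R <= e.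
Proof.
move=> e0; exists (Num.truncn (`|c| / e)).+1; split=> // n le_n.
have n0 : 0 < n%:R :> R by rewrite ltr0n; apply: leq_trans le_n.
rewrite ler_pdivrMr//; apply: le_trans (ler_norm _) _.
rewrite mulrC -ler_pdivrMr//.
have ce0 : 0 <= `|c| / e by rewrite divr_ge0// ltW.
have /andP[_ /ltW] := truncn_itv ce0.
by move/le_trans; apply; rewrite ler_nat.
Qed.

Lemma broken_line_sub {R : realType} {V : lmodType R} (d : nat -> V) m j w :
  broken_line d m j - w =
    (1 - (j %% m)%:R / m%:R) *: (d (j %/ m)%N - w) +
    ((j %% m)%:R / m%:R) *: (d (j %/ m).+1 - w).
Proof.
rewrite /broken_line !scalerBr addrACA -opprD -scalerDl.
by rewrite subrK scale1r.
Qed.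

(** The image under [f] and the constant increment [e] of the segment both distribute over the two
    weights, whose sum is 1; so only defects at nodes have to be estimated. *)
Lemma broken_line_drift {R : realType} {V : lmodType R} (f : V -> V)
    (d : nat -> V) m j : linear f -> (0 < m)%N ->
  let e := m%:R^-1 *: (d (j %/ m).+1 - d (j %/ m)%N) in
  f (broken_line d m j) - broken_line d m j.+1 =
    (1 - (j %% m)%:R / m%:R) *: (f (d (j %/ m)%N) - d (j %/ m)%N - e) +
    ((j %% m)%:R / m%:R) *: (f (d (j %/ m).+1) - d (j %/ m).+1 - e).
Proof.
move=> lf m0 e; rewrite broken_lineS// -/e opprD addrA /broken_line.
rewrite (linD lf) !(linZ lf); set t := _ / _; set i := (j %/ m)%N.
rewrite opprD addrACA -!scalerBr !(scalerBr _ _ e) addrACA -opprD -scalerDl.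
by rewrite subrK scale1r.
Qed.

(** A segment of [m] steps of length [h] falls short of [tau] by less than [h]. Over [i = n %/ m]
    segments the lag is at most [i h], and [i m h <= s <= tau m] bounds it by [tau]. *)
Lemma broken_line_index {R : realType} (h tau s : R) m n :
  0 < h -> 0 < tau -> (0 < m)%N -> m%:R * h <= tau -> tau < m.+1%:R * h ->
  s <= tau * m%:R -> n%:R * h <= s ->
  `|(n %/ m)%:R * tau - n%:R * h| <= tau.
Proof.
move=> h0 tau0 m0; rewrite -natr1 => mh_le mh_gt s_le nh_le.
have mR0 : 0 < m%:R :> R by rewrite ltr0n.
set i := (n %/ m)%N; rewrite ler_distl; apply/andP; split.
  rewrite lerBlDr -[X in _ + X]mul1r -mulrDl natr1.
  have ni : (n <= i.+1 * m)%N by rewrite ltnW// ltn_ceil.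
  apply: (@le_trans _ _ (i.+1%:R * (m%:R * h))); last by rewrite ler_wpM2l.
  by rewrite mulrA -natrM ler_wpM2r ?(ltW h0)// ler_nat.
have imn : i%:R * m%:R * h <= n%:R * h.
  by rewrite -natrM ler_wpM2r ?(ltW h0)// ler_nat leq_divM.
have ih : i%:R * h <= tau.
  rewrite -(ler_pM2r mR0) mulrAC; apply: le_trans imn _.
  exact: le_trans s_le.
have : i%:R * tau <= i%:R * ((m%:R + 1) * h) by rewrite ler_wpM2l// ltW.
by move/le_trans; apply; rewrite mulrDl mul1r mulrDr mulrA lerD.
Qed.

Lemma seminorm_avg_dist {R : realType} {V : lmodType R} (Q : V -> R) n
    (F : nat -> V) x e : seminorm Q -> (0 < n)%N ->
  (forall i, (i < n)%N -> Q (F i - x) <= e) ->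
  Q (n%:R^-1 *: \sum_(0 <= i < n) F i - x) <= e.
Proof.
move=> sQ n0 Fe.
have -> : n%:R^-1 *: \sum_(0 <= i < n) F i - x =
    n%:R^-1 *: \sum_(0 <= i < n) (F i - x).
  rewrite sumrB scalerBr; congr (_ - _).
  rewrite sumr_const_nat subn0 -[x *+ n]scaler_nat scalerA mulVf ?scale1r//.
  by rewrite pnatr_eq0 -lt0n.
exact: seminorm_avg_le.
Qed.

(** Discrete form of int_0^m (f(s+n) - f(s)) ds = int_0^n (f(s+m) - f(s)) ds. *)
Lemma sum_shiftB {V : zmodType} (f : nat -> V) m n :
  \sum_(0 <= i < m) f (i + n)%N - \sum_(0 <= i < m) f i =
    \sum_(0 <= i < n) (f (i + m)%N - f i).
Proof.
elim: n => [|n IH].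
  by under eq_bigr do rewrite addn0; rewrite subrr big_nil.
rewrite big_nat_recr//= -IH [RHS]addrAC; congr (_ - _).
have -> : f (n + m)%N - f n = \sum_(0 <= i < m) (f (i + n.+1)%N - f (i + n)%N).
  rewrite addnC -{2}(add0n n) -(telescope_sumr (fun i => f (i + n)%N))//.
  by apply: eq_bigr => i _; rewrite addnS.
by rewrite sumrB addrC subrK.
Qed.

(** * Locally equicontinuous semigroups and Chernoff products *)

Section Chernoff.
Context {R : realType} {V : lmodType R} (P : set (V -> R)).
Hypothesis P_seminorm : forall Q, P Q -> seminorm Q.
Hypothesis P_directed : forall Q1 Q2, P Q1 -> P Q2 ->
  exists2 Q, P Q & forall x, Q1 x <= Q x /\ Q2 x <= Q x.
Implicit Types (T F : R -> V -> V) (Q : V -> R) (x y z : V).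

Definition locally_equicontinuous T := forall s Q, P Q ->
  exists2 Q', P Q' & forall t x, 0 <= t -> t <= s -> Q (T t x) <= Q' x.

Record semigroup T : Prop := Semigroup {
  semigroup0 : T 0 = id;
  semigroupD : forall s t x, 0 <= s -> 0 <= t -> T (s + t) x = T s (T t x);
  semigroup_linear : forall t, 0 <= t -> linear (T t);
  semigroup_equicontinuous : locally_equicontinuous T;
  semigroup_cvg0 : forall Q e x, P Q -> 0 < e ->
    \forall h \near 0^'+, Q (T h x - x) <= e }.

(** The expansion F(h)x = x + hy + o(h) in each seminorm. For a semigroup this relation plays the
    role of the graph of the generator. *)
Definition right_derivative F x y := forall Q e, P Q -> 0 < e ->
  \forall h \near 0^'+, Q (F h x - x - h *: y) <= e * h.

Lemma semigroup_near0 T Q e x : semigroup T -> P Q -> 0 < e ->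
  exists2 t, 0 < t & forall h, 0 <= h -> h <= t -> Q (T h x - x) <= e.
Proof.
move=> sT PQ e0; apply: near0_itv; first exact: (semigroup_cvg0 sT _ PQ e0).
by rewrite semigroup0// subrr (seminorm0 (P_seminorm PQ)) ltW.
Qed.

Lemma semigroup_incr T Q Q' s x r t : semigroup T ->
  (forall t x, 0 <= t -> t <= s -> Q (T t x) <= Q' x) ->
  0 <= t -> t <= s -> 0 <= r -> Q (T (t + r) x - T t x) <= Q' (T r x - x).
Proof.
move=> sT QQ' t0 ts r0.
by rewrite semigroupD// -(linB (semigroup_linear sT t0)); exact: QQ'.
Qed.

(** Uniform continuity on [[0, s]]: an increment between two times is the image of an increment from
    time 0, and equicontinuity bounds it independently of the position. *)
Lemma semigroup_osc T Q Q' s x e t1 t2 r : semigroup T -> P Q ->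
  (forall t x, 0 <= t -> t <= s -> Q (T t x) <= Q' x) ->
  (forall h, 0 <= h -> h <= r -> Q' (T h x - x) <= e) ->
  0 <= t1 <= s -> 0 <= t2 <= s -> `|t1 - t2| <= r ->
  Q (T t1 x - T t2 x) <= e.
Proof.
move=> sT PQ QQ' Te /andP[t10 t1s] /andP[t20 t2s].
wlog le21 : t1 t2 t10 t1s t20 t2s / t2 <= t1.
  move=> H r12; have [le21|/ltW le12] := leP t2 t1; first exact: H.
  by rewrite (seminorm_distC (P_seminorm PQ)); apply: H => //; rewrite distrC.
rewrite ger0_norm ?subr_ge0// => r12.
have {1}-> : t1 = t2 + (t1 - t2) by rewrite addrC subrK.
have sub0 : 0 <= t1 - t2 by rewrite subr_ge0.
by apply: le_trans (semigroup_incr x sT QQ' t20 t2s sub0) _; exact: Te.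
Qed.

(** With m the integer part of tau/h, the vectors g/m and (h/tau)g differ by o(h). This matches the
    increment of a broken line with [m] substeps against the derivative [z]. *)
Lemma right_derivative_slope F Q d z g (tau a c : R) :
  P Q -> 0 < tau -> a < c ->
  right_derivative F d z -> Q (z - tau^-1 *: g) <= a ->
  \forall h \near 0^'+,
    Q (F h d - d - (Num.truncn (tau / h))%:R^-1 *: g) <= c * h.
Proof.
move=> PQ tau0 ac dF za; have sQ := P_seminorm PQ.
(* The gap [c - a] is split evenly between the remainder of the derivative and the rounding of
   tau/h. *)
have [b b0 cE] : exists2 b, 0 < b & c = a + b + b.
  by exists ((c - a) / 2); [rewrite divr_gt0// subr_gt0|field].
near=> h.
have h0 : 0 < h by near: h; exact: nbhs_right_gt.
have : 1 <= (Num.truncn (tau / h))%:R :> R by near: h; exact: near0_truncn.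
have : Q g / (tau * b) <= (Num.truncn (tau / h))%:R.
  by near: h; exact: near0_truncn.
have /andP[] := @truncn_itv R (tau / h) (divr_ge0 (ltW tau0) (ltW h0)).
set m := Num.truncn _ => m_le m_gt m_geg m_ge1.
have m0 : 0 < m%:R :> R by lra.
have h_neq0 := lt0r_neq0 h0; have m_neq0 := lt0r_neq0 m0.
have tau_neq0 := lt0r_neq0 tau0.
have Fdh : Q (F h d - d - h *: z) <= b * h by near: h; exact: dF.
have -> : F h d - d - m%:R^-1 *: g = (F h d - d - h *: z) +
    (h *: (z - tau^-1 *: g) + (h / tau - m%:R^-1) *: g).
  rewrite scalerBr scalerBl scalerA [h *: z - _ + _]addrA subrK.
  by rewrite [RHS]addrA subrK.
apply: le_trans (seminormD sQ _ _) _.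
apply: le_trans (lerD Fdh (seminormD sQ _ _)) _.
rewrite (seminormZ_ge0 sQ _ (ltW h0)) (seminormZ sQ).
have hza : h * Q (z - tau^-1 *: g) <= h * a by rewrite ler_wpM2l// ltW.
suff : `|h / tau - m%:R^-1| * Q g <= b * h.
  by rewrite cE !mulrDl [a * h]mulrC; lra.
move: m_le m_gt; rewrite -natr1 ler_pdivlMr// ltr_pdivrMr// => mh_le mh_gt.
have -> : `|h / tau - m%:R^-1| = (tau - m%:R * h) / (m%:R * tau).
  rewrite ler0_norm; first by field; rewrite m_neq0 tau_neq0.
  by rewrite subr_le0 ler_pdivrMr// ler_pdivlMl.
have m_geg' : Q g <= m%:R * (tau * b).
  by rewrite -ler_pdivrMr// mulr_gt0.
(* The rounding error [tau - m h] is below [h], and [m] was taken large enough to absorb [Q g]. *)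
apply: (@le_trans _ _ (h / (m%:R * tau) * (m%:R * (tau * b)))); last first.
  suff -> : h / (m%:R * tau) * (m%:R * (tau * b)) = b * h by [].
  by field; rewrite m_neq0 tau_neq0.
apply: ler_pM => //.
- by rewrite divr_ge0 ?subr_ge0// mulr_ge0// ltW.
- exact: seminorm_ge0.
- by rewrite ler_wpM2r ?invr_ge0 ?mulr_ge0 ?(ltW tau0) ?(ltW m0)//; lra.
Unshelve. all: by end_near. Qed.


(** Product rule from T1 T2 x - x - h(y+z) = T1(T2 x - x - hz) + h(T1 z - z) + (T1 x - x - hy), all
    operators at time h: equicontinuity handles the first term, continuity of T1 at time 0 the
    second. *)
Lemma right_derivative_comp T1 T2 x y z : semigroup T1 ->
  right_derivative T1 x y -> right_derivative T2 x z ->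
  right_derivative (fun s => T1 s \o T2 s) x (y + z).
Proof.
move=> sT1 dy dz Q e PQ e0; have sQ := P_seminorm PQ.
have [Q' PQ' TQ'] := semigroup_equicontinuous sT1 1 PQ.
have e3 : 0 < e / 3 by rewrite divr_gt0.
near=> h.
have h0 : 0 < h by near: h; exact: nbhs_right_gt.
have h1 : h <= 1 by near: h; exact: nbhs_right_le.
have Th := semigroup_linear sT1 (ltW h0).
have dyh : Q (T1 h x - x - h *: y) <= e / 3 * h by near: h; exact: dy.
have dzh : Q' (T2 h x - x - h *: z) <= e / 3 * h by near: h; exact: dz.
have Tz : Q (T1 h z - z) <= e / 3.
  by near: h; exact: (semigroup_cvg0 sT1 _ PQ e3).
have hTz : h * Q (T1 h z - z) <= h * (e / 3) by rewrite ler_wpM2l// ltW.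
rewrite /= (_ : _ - _ - _ = T1 h (T2 h x - x - h *: z) +
    (h *: (T1 h z - z) + (T1 h x - x - h *: y))); last first.
  rewrite !(linB Th) (linZ Th) scalerBr scalerDr.
  rewrite [RHS]addrA subrKA [_ - h *: z in RHS]addrAC -[_ - x - h *: y]addrA.
  by rewrite subrKA [RHS]addrACA -opprD [h *: z + _]addrC.
apply: le_trans (seminormD sQ _ _) _.
have := le_trans (TQ' _ _ (ltW h0) h1) dzh.
have := seminormD sQ (h *: (T1 h z - z)) (T1 h x - x - h *: y).
rewrite (seminormZ_ge0 sQ _ (ltW h0)); lra.
Unshelve. all: by end_near. Qed.

(** * Riemann sums of orbits and density of the domain of the generator *)

Section Density.
Context T (sT : semigroup T).

(** Left Riemann sum, on [n] equal cells, of the mean of s |-> T(s)x over [0, t]. *)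
Definition average t x n : V :=
  n%:R^-1 *: \sum_(0 <= i < n) T (i%:R * (t / n%:R)) x.

(** The fine sum is grouped by coarse cells; inside a cell, each fine value differs from the value
    at the left end by an increment over a time at most [t / n]. *)
Lemma average_refine t x Q Q' e n m : P Q -> 0 <= t -> (0 < n)%N -> (0 < m)%N ->
  (forall s x, 0 <= s -> s <= t -> Q (T s x) <= Q' x) ->
  (forall h, 0 <= h -> h <= t / n%:R -> Q' (T h x - x) <= e) ->
  Q (average t x n - average t x (n * m)) <= e.
Proof.
move=> PQ t0 n0 m0 QQ' Te; have sQ := P_seminorm PQ.
have nR0 : 0 < n%:R :> R by rewrite ltr0n.
have mR0 : 0 < m%:R :> R by rewrite ltr0n.
rewrite (seminorm_distC sQ) /average big_nat_mul natrM invfM -scalerA.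
rewrite [m%:R^-1 *: _]scaler_sumr -scalerBr -sumrB.
apply: seminorm_avg_le => // i ni.
rewrite -[X in \sum_(X <= j < _) _]add0n big_addn mulSn addnK.
apply: seminorm_avg_dist => // j jm.
have -> : (j + i * m)%:R * (t * (n%:R^-1 / m%:R)) =
    i%:R * (t / n%:R) + j%:R * (t / n%:R / m%:R).
  by rewrite natrD natrM; field; rewrite !lt0r_neq0.
have tn0 : 0 <= t / n%:R by rewrite divr_ge0.
have it : i%:R * (t / n%:R) <= t.
  by rewrite mulrA ler_pdivrMr// mulrC ler_wpM2l// ler_nat ltnW.
have jt0 : 0 <= j%:R * (t / n%:R / m%:R) by rewrite mulr_ge0// divr_ge0.
have := semigroup_incr x sT QQ' (mulr_ge0 (ler0n _ i) tn0) it jt0.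
move/le_trans; apply; apply: Te => //.
by rewrite mulrA ler_pdivrMr// mulrC ler_wpM2l// ler_nat ltnW.
Qed.

(** Discrete form of (T(s) - I) int_0^t T(r)x dr = int_0^s T(r)(T(t)x - x) dr, for [s] a multiple of
    the mesh. *)
Lemma average_semigroupB t x n k : 0 <= t -> (0 < n)%N ->
  T (k%:R * (t / n%:R)) (average t x n) - average t x n =
    n%:R^-1 *: \sum_(0 <= i < k) T (i%:R * (t / n%:R)) (T t x - x).
Proof.
move=> t0 n0; have tn0 : 0 <= t / n%:R by rewrite divr_ge0.
have kt0 (i : nat) : 0 <= i%:R * (t / n%:R) by rewrite mulr_ge0.
rewrite /average (linZ (semigroup_linear sT (kt0 k))) -scalerBr; congr (_ *: _).
rewrite (lin_sum (semigroup_linear sT (kt0 k))).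
pose f i := T (i%:R * (t / n%:R)) x.
rewrite (eq_bigr (fun i => f (i + k)%N)); last first.
  by move=> i _; rewrite /f natrD mulrDl addrC (semigroupD sT).
rewrite sum_shiftB; apply: eq_bigr => i _.
rewrite (linB (semigroup_linear sT (kt0 i))) /f natrD mulrDl; congr (_ - _).
by rewrite [n%:R * _]mulrC divfK ?pnatr_eq0 -?lt0n// (semigroupD sT).
Qed.

Lemma average_cauchy t x Q e : P Q -> 0 <= t -> 0 < e ->
  exists N : nat, forall m n, (N <= m)%N -> (N <= n)%N ->
    Q (average t x m - average t x n) <= e.
Proof.
move=> PQ t0 e0; have sQ := P_seminorm PQ.
have [Q' PQ' QQ'] := semigroup_equicontinuous sT t PQ.
have e2 : 0 < e / 2 by rewrite divr_gt0.
have [r r0 Tr] := semigroup_near0 x sT PQ' e2.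
have [N [N0 tN]] := near_inv_nat t r0.
have refine n k : (N <= n)%N -> (0 < k)%N ->
    Q (average t x n - average t x (n * k)) <= e / 2.
  move=> Nn k0; apply: average_refine => //; first exact: leq_trans Nn.
    exact: QQ'.
  by move=> h h0 htn; apply: Tr => //; apply: le_trans htn (tN _ Nn).
(* The two sums are compared through their common refinement with [m * n] cells. *)
exists N => m n Nm Nn; have m0 := leq_trans N0 Nm; have n0 := leq_trans N0 Nn.
have := refine m n Nm n0; have := refine n m Nn m0; rewrite [(n * m)%N]mulnC.
rewrite (seminorm_distC sQ).
have := seminorm_dist sQ (average t x m) (average t x (m * n)) (average t x n).
lra.
Qed.

(** Here [w] is the mean of the orbit over [0, t]. It is replaced by a Riemann sum [S], and [h] by a
    multiple [s] of the mesh, where [average_semigroupB] applies. *)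
Lemma right_derivative_average t x w : 0 < t ->
  (forall Q e, P Q -> 0 < e ->
    exists N : nat, forall n, (N <= n)%N -> Q (average t x n - w) <= e) ->
  right_derivative T w (t^-1 *: (T t x - x)).
Proof.
move=> t0 avg_w Q e PQ e0; have sQ := P_seminorm PQ.
have [z zE] : exists z, z = T t x - x by exists (T t x - x).
rewrite -zE.
have [Q1 PQ1 TQ1] := semigroup_equicontinuous sT (t + 1) PQ.
have [Q2 PQ2 Q2_ge] := P_directed PQ PQ1; have sQ2 := P_seminorm PQ2.
(* With tolerance [e * t], the [k] terms of the sum, divided by [n], contribute at most
   [e * (k * t / n) <= e * h]. *)
have [r r0 Tr] := semigroup_near0 z sT PQ (mulr_gt0 e0 t0).
near=> h.
have h0 : 0 < h by near: h; exact: nbhs_right_gt.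
have h1 : h <= 1 by near: h; exact: nbhs_right_le.
have hr : h <= r by near: h; exact: nbhs_right_le.
(* An arbitrary slack [eta] allows [n] to be chosen after [h]; it is shared among the replacement of
   [w] (twice), that of [h], and the rounding of [h] in the term along [z]. *)
apply/ler_addgt0Pr => eta eta0.
have eta4 : 0 < eta / 4 by rewrite divr_gt0.
have [N1 avgN1] := avg_w _ _ PQ2 eta4.
have [r' r'0 Tr'] := semigroup_near0 x sT PQ1 eta4.
have [N2 [_ tN2]] := near_inv_nat t r'0.
have [N3 [N30 zN3]] := near_inv_nat (Q z) eta4.
pose n := (N1 + (N2 + N3))%N.
have n0 : (0 < n)%N by rewrite /n !addn_gt0 N30 !orbT.
have {}avgN1 : Q2 (average t x n - w) <= eta / 4.
  by apply: avgN1; rewrite /n leq_addr.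
have {}tN2 : t / n%:R <= r' by apply: tN2; rewrite /n addnCA leq_addr.
have {}zN3 : Q z / n%:R <= eta / 4 by apply: zN3; rewrite /n addnA leq_addl.
have nR0 : 0 < n%:R :> R by rewrite ltr0n.
have tn0 : 0 < t / n%:R by rewrite divr_gt0.
set S := average t x n in avgN1.
have /andP[] := @truncn_itv R (h / (t / n%:R)) (divr_ge0 (ltW h0) (ltW tn0)).
set k := Num.truncn _; rewrite ler_pdivlMr// ltr_pdivrMr// -natr1 mulrDl mul1r.
set s := k%:R * (t / n%:R) => sh hs.
have s0 : 0 <= s by rewrite mulr_ge0// ltW.
have lTh := semigroup_linear sT (ltW h0); have lTs := semigroup_linear sT s0.
have hs0 : 0 <= h - s by rewrite subr_ge0.
have part1 : Q (T h w - T h S) <= eta / 4.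
  rewrite -(linB lTh); apply: le_trans (TQ1 _ _ (ltW h0) _) _; first lra.
  by apply: le_trans (Q2_ge _).2 _; rewrite (seminorm_distC sQ2).
have part2 : Q (T h S - T s S) <= eta / 4.
  have {1}-> : h = s + (h - s) by rewrite addrC subrK.
  rewrite (semigroupD sT)// -(linB lTs).
  have lThs := semigroup_linear sT hs0.
  rewrite /S /average (linZ lThs) (lin_sum lThs) -scalerBr -sumrB.
  rewrite (linZ lTs) (lin_sum lTs); apply: seminorm_avg_le => // i ni.
  have it0 : 0 <= i%:R * (t / n%:R) by rewrite mulr_ge0// ltW.
  have it1 : i%:R * (t / n%:R) <= t.
    by rewrite mulrA ler_pdivrMr// mulrC ler_wpM2l ?(ltW t0)// ler_nat ltnW.
  rewrite -(semigroupD sT)// [h - s + _]addrC (semigroupD sT)//.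
  rewrite -(linB (semigroup_linear sT it0)) -(semigroupD sT)//.
  apply: le_trans (TQ1 _ _ _ _) _; [by rewrite addr_ge0|lra|].
  by apply: Tr' => //; lra.
have part3 : Q (T s S - S - h *: (t^-1 *: z)) <= e * h + eta / 4.
  have -> : T s S - S - h *: (t^-1 *: z) =
      n%:R^-1 *: \sum_(0 <= i < k) (T (i%:R * (t / n%:R)) z - z) +
      (s / t - h / t) *: z.
    rewrite /S average_semigroupB ?(ltW t0)// -zE sumrB scalerBr scalerA.
    rewrite sumr_const_nat subn0 -[z *+ k]scaler_nat scalerA -addrA.
    congr (_ + _).
    rewrite -scaleNr -scalerDl -scaleNr; congr (_ *: _).
    by rewrite /s; field; rewrite !lt0r_neq0.
  apply: le_trans (seminormD sQ _ _) _; apply: lerD.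
    rewrite (seminormZ_ge0 sQ) ?invr_ge0// ler_pdivrMl//.
    apply: (@le_trans _ _ (k%:R * (e * t))).
      apply: seminorm_sum_le => // i ik; apply: Tr.
        by rewrite mulr_ge0// ltW.
      apply: le_trans hr; apply: le_trans sh.
      by rewrite ler_wpM2r ?(ltW tn0)// ler_nat ltnW.
    rewrite mulrCA [n%:R * _]mulrCA ler_wpM2l ?(ltW e0)//.
    by rewrite [n%:R * h]mulrC -ler_pdivrMr// -mulrA.
  rewrite (seminormZ sQ) -mulrBl normrM (@ler0_norm _ (s - h)) ?subr_le0//.
  rewrite gtr0_norm ?invr_gt0// opprB.
  apply: le_trans zN3; rewrite [leRHS]mulrC ler_wpM2r ?seminorm_ge0//.
  by rewrite ler_pdivrMr// mulrC; lra.
have := seminorm_dist sQ (T h w) (T h S) (T s S).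
have -> : T h w - w - h *: (t^-1 *: z) =
    (T h w - T s S) + ((T s S - S - h *: (t^-1 *: z)) + (S - w)).
  by rewrite [T s S - S - _ + _]addrACA subrK subrKA -addrA [- w - _]addrC.
have := seminormD sQ (T h w - T s S)
  ((T s S - S - h *: (t^-1 *: z)) + (S - w)).
have := seminormD sQ (T s S - S - h *: (t^-1 *: z)) (S - w).
have := le_trans (Q2_ge _).1 avgN1.
lra.
Unshelve. all: by end_near. Qed.

Lemma right_derivative_dense x Q e :
  (forall u : nat -> V,
    (forall Q e, P Q -> 0 < e -> exists N : nat, forall m n,
      (N <= m)%N -> (N <= n)%N -> Q (u m - u n) <= e) ->
    exists l, forall Q e, P Q -> 0 < e ->
      exists N : nat, forall n, (N <= n)%N -> Q (u n - l) <= e) ->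
  P Q -> 0 < e -> exists w y, right_derivative T w y /\ Q (w - x) <= e.
Proof.
move=> complete PQ e0; have sQ := P_seminorm PQ.
have e2 : 0 < e / 2 by rewrite divr_gt0.
have [t t0 Tt] := semigroup_near0 x sT PQ e2.
have [w avg_w] := complete (average t x)
  (fun Q e PQ => average_cauchy x PQ (ltW t0)).
exists w, (t^-1 *: (T t x - x)); split; first exact: right_derivative_average.
have [N avgN] := avg_w _ _ PQ e2.
have := avgN N.+1 (leqnSn N).
have : Q (average t x N.+1 - x) <= e / 2.
  apply: seminorm_avg_dist => // i iN; apply: Tt.
    by rewrite mulr_ge0// divr_ge0// ltW.
  by rewrite mulrA ler_pdivrMr// mulrC ler_wpM2l ?(ltW t0)// ler_nat ltnW.
rewrite [Q (average _ _ _ - w)](seminorm_distC sQ).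
have := seminorm_dist sQ w (average t x N.+1) x; lra.
Qed.

End Density.

Lemma right_derivative_dist T x y Q Q' s t tau a : semigroup T -> P Q ->
  (forall t x, 0 <= t -> t <= s -> Q (T t x) <= Q' x) ->
  0 <= t -> t <= s -> 0 < tau ->
  Q' (T tau x - x - tau *: y) <= a * tau ->
  Q (T t y - tau^-1 *: (T (t + tau) x - T t x)) <= a.
Proof.
move=> sT PQ QQ' t0 ts tau0 a_tau; have sQ := P_seminorm PQ.
have lT := semigroup_linear sT t0.
have -> : T t y - tau^-1 *: (T (t + tau) x - T t x) =
    - (tau^-1 *: T t (T tau x - x - tau *: y)).
  rewrite (semigroupD sT _ t0 (ltW tau0)) !(linB lT) (linZ lT).
  by rewrite [in RHS]scalerBr scalerK ?lt0r_neq0// opprB.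
rewrite (seminormN sQ) (seminormZ_ge0 sQ) ?invr_ge0 ?(ltW tau0)//.
by rewrite ler_pdivrMl// mulrC; exact: le_trans (QQ' _ _ t0 ts) a_tau.
Qed.

(** * Comparison of the powers of F(h) with the semigroup along a broken line *)

Section Approximation.
Context F T (D : V -> V -> Prop).
Hypothesis sT : semigroup T.
Hypothesis F_linear : forall h, 0 <= h -> linear (F h).
Hypothesis F_stable : forall s Q, P Q -> exists2 Q', P Q' &
  forall h n x, 0 <= h -> n%:R * h <= s -> Q (iter n (F h) x) <= Q' x.
Hypothesis F_derivative : forall d z, D d z -> right_derivative F d z.
Hypothesis D_core : forall x y, right_derivative T x y ->
  forall Q e, P Q -> 0 < e ->
    exists d z, [/\ D d z, Q (d - x) <= e & Q (z - y) <= e].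

Lemma right_derivative_semigroup x y t : 0 <= t ->
  right_derivative T x y -> right_derivative T (T t x) (T t y).
Proof.
move=> t0 dx Q e PQ e0; have [Q' PQ' QQ'] := semigroup_equicontinuous sT t PQ.
near=> h.
have h0 : 0 <= h by near: h; exact: nbhs_right_ge.
have -> : T h (T t x) - T t x - h *: T t y = T t (T h x - x - h *: y).
  have lT := semigroup_linear sT t0.
  rewrite !(linB lT) (linZ lT) -(semigroupD sT x h0 t0).
  by rewrite -(semigroupD sT x t0 h0) [h + t]addrC.
apply: le_trans (QQ' _ _ t0 (lexx t)) _.
by near: h; exact: dx.
Unshelve. all: by end_near. Qed.

(* Points of the core close, in the graph norm, to [T (i tau) x] are joined by
   a broken line; it solves the Cauchy problem up to a small error and, unlike
   the orbit of x itself, stays in the span of finitely many points of D. *)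
Lemma core_chain x y tau Q e : right_derivative T x y -> 0 <= tau -> P Q ->
  0 < e -> exists d z : nat -> V, forall i,
    [/\ D (d i) (z i), Q (d i - T (i%:R * tau) x) <= e
      & Q (z i - T (i%:R * tau) y) <= e].
Proof.
move=> dx tau0 PQ e0.
have /choice[d /choice[z dz]] : forall i : nat, exists d, exists z,
    [/\ D d z, Q (d - T (i%:R * tau) x) <= e & Q (z - T (i%:R * tau) y) <= e].
  move=> i; apply: D_core => //; apply: right_derivative_semigroup => //.
  by rewrite mulr_ge0.
by exists d, z.
Qed.

Lemma chernoff_derivative x y s Q e : right_derivative T x y -> P Q ->
  0 < s -> 0 < e ->
  \forall h \near 0^'+, forall n, n%:R * h <= s ->
    Q (iter n (F h) x - T (n%:R * h) x) <= e.
Proof.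
move=> dx PQ s0 e0; have sQ := P_seminorm PQ.
have [Q1 PQ1 FQ1] := F_stable s PQ; have sQ1 := P_seminorm PQ1.
have [Q2 PQ2 Q2_ge] := P_directed PQ PQ1; have sQ2 := P_seminorm PQ2.
(* The horizon [s + 3] covers all node times [i tau] with [i <= N], which are at most [s + 2]. *)
have [Q3 PQ3 TQ3] := semigroup_equicontinuous sT (s + 3) PQ2.
(* The final error is at most [c / 8] at the start, [s * c] of drift and [c / 8 + c] at the end. *)
have [c [c0 ce cse]] : exists c : R, [/\ 0 < c, c <= e / 6 & s * c <= e / 6].
  have s1 : 0 < 1 + s by rewrite addr_gt0.
  exists (e / 6 / (1 + s)); split; first by rewrite !divr_gt0.
  - by rewrite ler_pdivrMr// ler_peMr ?lerDl ?divr_ge0 ?ltW.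
  - by rewrite mulrA ler_pdivrMr// mulrC ler_wpM2l ?divr_ge0 ?(ltW e0)//; lra.
have [r1 r10 Tx] := semigroup_near0 x sT PQ3 c0.
have c8 : 0 < c / 8 by rewrite divr_gt0.
have [r2 r20 Ty] := semigroup_near0 y sT PQ3 c8.
have /filter_ex[tau [tau0 tau1 taur1 taur2 dx_tau]] :
    \forall t \near (0 : R)^'+,
    [/\ 0 < t, t <= 1, t <= r1 / 2, t <= r2
      & Q3 (T t x - x - t *: y) <= c / 8 * t].
  near=> t; split; near: t; [exact: nbhs_right_gt| | | |exact: dx];
    by apply: nbhs_right_le; rewrite ?divr_gt0.
have taur : tau + tau <= r1 by lra.
(* The accuracy carries a factor [tau] because differences of nodes are divided by [tau] in the
   slopes. *)
have [d [z dz]] := core_chain dx (ltW tau0) PQ2 (mulr_gt0 c8 tau0).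
have c8t : c / 8 * tau <= c / 8 by rewrite ler_piMr// ltW.
(* Node times may run ahead of [j h] by [tau], so the segments in use start no later than [s + tau];
   hence the offset 2. *)
pose N := (Num.truncn (s / tau)).+2.
have Ns (i : nat) : (i <= N)%N -> i%:R * tau <= s + 2.
  move=> iN; apply: (@le_trans _ _ (N%:R * tau)).
    by rewrite ler_wpM2r ?(ltW tau0)// ler_nat.
  have /andP[+ _] := @truncn_itv R (s / tau) (divr_ge0 (ltW s0) (ltW tau0)).
  by rewrite /N -addn2 natrD mulrDl ler_pdivlMr//; lra.
have itau_ge0 (i : nat) : 0 <= i%:R * tau by rewrite mulr_ge0// ltW.
(* One eighth of [c] comes from the divided difference of the orbit, two from the errors of the two
   nodes. *)
have slope (i : nat) : (i <= N)%N ->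
    Q2 (T (i%:R * tau) y - tau^-1 *: (d i.+1 - d i)) <= c * 3 / 8.
  move=> iN; have iNs := Ns i iN.
  apply: le_trans (seminorm_dist sQ2 _
    (tau^-1 *: (T (i%:R * tau + tau) x - T (i%:R * tau) x)) _) _.
  have its : i%:R * tau <= s + 3 by lra.
  have := right_derivative_dist sT PQ2 TQ3 (itau_ge0 i) its tau0 dx_tau.
  rewrite -scalerBr (seminormZ_ge0 sQ2) ?invr_ge0 ?(ltW tau0)//.
  suff : tau^-1 * Q2
      (T (i%:R * tau + tau) x - T (i%:R * tau) x - (d i.+1 - d i)) <= c * 2 / 8.
    by lra.
  rewrite ler_pdivrMl// opprB [d i - _]addrC addrACA [- _ + d i]addrC.
  have [_ di _] := dz i; have [_ di1 _] := dz i.+1.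
  rewrite -natr1 mulrDl mul1r in di1.
  apply: le_trans (seminormD sQ2 _ _) _.
  by rewrite [X in X + _](seminorm_distC sQ2); lra.
have slope0 (i : nat) : (i <= N)%N ->
    Q1 (z i - tau^-1 *: (d i.+1 - d i)) <= c * 5 / 8.
  move=> iN; apply: le_trans (Q2_ge _).2 _; have := slope i iN.
  have [_ _] := dz i; have := seminorm_dist sQ2 (z i) (T (i%:R * tau) y)
    (tau^-1 *: (d i.+1 - d i)); lra.
(* The right end of a segment needs in addition that the orbit of [y] moves little during [tau]. *)
have slope1 (i : nat) : (i <= N)%N ->
    Q1 (z i.+1 - tau^-1 *: (d i.+1 - d i)) <= c * 5 / 8.
  move=> iN; have its : i%:R * tau <= s + 3 by have := Ns i iN; lra.
  apply: le_trans (Q2_ge _).2 _.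
  have := le_trans (semigroup_incr y sT TQ3 (itau_ge0 i) its (ltW tau0))
    (Ty tau (ltW tau0) taur2).
  have := slope i iN.
  have [_ _] := dz i.+1; rewrite -natr1 mulrDl mul1r.
  have := seminorm_dist sQ2 (z i.+1) (T (i%:R * tau + tau) y)
    (tau^-1 *: (d i.+1 - d i)).
  have := seminorm_dist sQ2 (T (i%:R * tau + tau) y) (T (i%:R * tau) y)
    (tau^-1 *: (d i.+1 - d i)); lra.
have c5 : c * 5 / 8 < c by lra.
near=> h.
have h0 : 0 < h by near: h; exact: nbhs_right_gt.
(* As [N] is fixed before [h], these are finitely many conditions on [h], and they hold
   simultaneously near 0. *)
have step : forall i : 'I_N,
    Q1 (F h (d i) - d i -
      (Num.truncn (tau / h))%:R^-1 *: (d i.+1 - d i)) <= c * h /\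
    Q1 (F h (d i.+1) - d i.+1 -
      (Num.truncn (tau / h))%:R^-1 *: (d i.+1 - d i)) <= c * h.
  near: h; apply: filter_forall => i; have iN := ltnW (ltn_ord i).
  have [Di _ _] := dz i; have [Di1 _ _] := dz i.+1.
  near=> h; split; near: h.
  - exact: right_derivative_slope (F_derivative Di) (slope0 i iN).
  - exact: right_derivative_slope (F_derivative Di1) (slope1 i iN).
have : 1 <= (Num.truncn (tau / h))%:R :> R by near: h; exact: near0_truncn.
have : s / tau <= (Num.truncn (tau / h))%:R by near: h; exact: near0_truncn.
have /andP[] := @truncn_itv R (tau / h) (divr_ge0 (ltW tau0) (ltW h0)).
set m := Num.truncn _ in step *.
rewrite ler_pdivlMr// ltr_pdivrMr// ler_pdivrMr// ler1n.
rewrite [m%:R * tau]mulrC => mh_le mh_gt s_le m0 n nh.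
have indexN j : (j <= n)%N -> (j %/ m < N)%N.
  move=> jn; have jh : j%:R * h <= s.
    by apply: le_trans nh; rewrite ler_wpM2r ?ler_nat// ltW.
  have := broken_line_index h0 tau0 m0 mh_le mh_gt s_le jh.
  rewrite ler_distl => /andP[_].
  have /andP[_] := @truncn_itv R (s / tau) (divr_ge0 (ltW s0) (ltW tau0)).
  rewrite ltr_pdivrMr// => lt_s /le_lt_trans le_j.
  rewrite -(ltr_nat R) -(ltr_pM2r tau0) /N -natr1 mulrDl mul1r.
  by apply: le_j; rewrite ltrD2r; exact: le_lt_trans lt_s.
pose v := broken_line d m.
have theta01 j : 0 <= ((j %% m)%:R / m%:R : R) <= 1.
  apply/andP; split; rewrite ?divr_ge0// ler_pdivrMr ?ltr0n// mul1r ler_nat.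
  by rewrite ltnW// ltn_mod.
have drift : Q (iter n (F h) (d 0%N) - v n) <= n%:R * (c * h).
  have -> : d 0%N = v 0%N.
    by rewrite /v /broken_line div0n mod0n mul0r subr0 scale0r scale1r addr0.
  apply: (seminorm_iter_drift (Q' := Q1)) => //; first exact/F_linear/ltW.
    move=> k w kn; apply: FQ1; first exact: ltW.
    by apply: le_trans nh; rewrite ler_wpM2r ?ler_nat// ltW.
  move=> j jn; rewrite /v broken_line_drift//; last exact/F_linear/ltW.
  have [le1 le2] := step (Ordinal (indexN j (ltnW jn))).
  exact: (seminorm_convex sQ1 (theta01 j) le1 le2).
(* [v n] is a convex combination of two nodes whose times are within [tau] and [2 tau] of [n h],
   hence within [r1]. *)
have tail : Q (v n - T (n%:R * h) x) <= c / 8 + c.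
  have nN := indexN n (leqnn n).
  have dist_n := broken_line_index h0 tau0 m0 mh_le mh_gt s_le nh.
  have nh0 : 0 <= n%:R * h by rewrite mulr_ge0// ltW.
  have near_node i : (i <= N)%N -> `|i%:R * tau - n%:R * h| <= r1 ->
      Q (d i - T (n%:R * h) x) <= c / 8 + c.
    move=> iN ir; apply: le_trans (Q2_ge _).1 _.
    apply: le_trans (seminorm_dist sQ2 _ (T (i%:R * tau) x) _) _.
    have [_ di _] := dz i; apply: lerD; first exact: le_trans c8t.
    have iNs := Ns i iN.
    apply: (semigroup_osc sT PQ2 TQ3 Tx) => //; rewrite ?itau_ge0 ?nh0/=.
      by apply: le_trans iNs _; rewrite lerD2l ler_nat.
    by apply: le_trans nh _; rewrite lerDl.
  rewrite /v broken_line_sub; apply: seminorm_convex => //; apply: near_node.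
  - exact: ltnW.
  - by apply: le_trans dist_n _; apply: le_trans taur; rewrite lerDl ltW.
  - exact: nN.
  - rewrite -natr1 mulrDl mul1r addrAC; apply: le_trans (ler_normD _ _) _.
    by rewrite (gtr0_norm tau0); apply: le_trans taur; rewrite lerD2r.
have lFn := linear_iter n (F_linear (ltW h0)).
apply: le_trans (seminorm_dist sQ _ (iter n (F h) (d 0%N)) _) _.
have head : Q (iter n (F h) x - iter n (F h) (d 0%N)) <= c / 8.
  rewrite -(linB lFn); apply: le_trans (FQ1 _ _ _ (ltW h0) nh) _.
  apply: le_trans (Q2_ge _).2 _; rewrite (seminorm_distC sQ2).
  by have [_ + _] := dz 0%N; rewrite mul0r (semigroup0 sT) => /le_trans; apply.
have := seminorm_dist sQ (iter n (F h) (d 0%N)) (v n) (T (n%:R * h) x).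
have : n%:R * (c * h) <= s * c.
  by rewrite mulrCA mulrC ler_wpM2r// ltW.
lra.
Unshelve. all: by end_near. Qed.

(** Equicontinuity of the powers of F(h) and of T up to time [s] carries the convergence from a
    nearby [w] in the domain to [x]. *)
Lemma chernoff_dense s Q e :
  (forall x Q e, P Q -> 0 < e ->
    exists w y, right_derivative T w y /\ Q (w - x) <= e) ->
  P Q -> 0 < s -> 0 < e -> forall x,
  \forall h \near 0^'+, forall n, n%:R * h <= s ->
    Q (iter n (F h) x - T (n%:R * h) x) <= e.
Proof.
move=> dense PQ s0 e0 x; have sQ := P_seminorm PQ.
have [Q1 PQ1 FQ1] := F_stable s PQ.
have [Q2 PQ2 TQ2] := semigroup_equicontinuous sT s PQ.
have [Q3 PQ3 Q3_ge] := P_directed PQ1 PQ2; have sQ3 := P_seminorm PQ3.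
have e3 : 0 < e / 3 by rewrite divr_gt0.
have [w [y [dw wx]]] := dense x Q3 _ PQ3 e3.
near=> h => n nh.
have h0 : 0 < h by near: h; exact: nbhs_right_gt.
have : Q (iter n (F h) w - T (n%:R * h) w) <= e / 3.
  by move: n nh; near: h; exact: chernoff_derivative dw _ _ _.
have nh0 : 0 <= n%:R * h by rewrite mulr_ge0// ltW.
have := le_trans (FQ1 h n (x - w) (ltW h0) nh) (Q3_ge _).1.
rewrite (linB (linear_iter n (F_linear (ltW h0)))) (seminorm_distC sQ3).
have := le_trans (TQ2 (n%:R * h) (w - x) nh0 nh) (Q3_ge _).2.
rewrite (linB (semigroup_linear sT nh0)).
have := seminorm_dist sQ (iter n (F h) x) (iter n (F h) w) (T (n%:R * h) x).
have := seminorm_dist sQ (iter n (F h) w) (T (n%:R * h) w) (T (n%:R * h) x).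
lra.
Unshelve. all: by end_near. Qed.

End Approximation.

End Chernoff.

(** * From seminorms valued in the scalars to real seminorms *)

Section Scalars.
Context (R : realType) (k : scalar_kind).

(** Taking the real part loses nothing on seminorm values: a nonnegative element of [R[i]] has zero
    imaginary part. *)
Definition to_real : scalars R k -> R :=
  match k with RealScalars => id | ComplexScalars => @complex.Re R end.

Lemma to_realK (z : scalars R k) : 0 <= z -> of_real k (to_real z) = z.
Proof.
rewrite /to_real /of_real; case: k z => //= z.
by rewrite lecE /= => /andP[/eqP im0 _]; case: z im0 => a b /= ->.
Qed.

Lemma of_realK : cancel (of_real k) to_real.
Proof. by rewrite /to_real /of_real; case: k. Qed.

Lemma of_realD : {morph @of_real R k : x y / x + y}.
Proof. by rewrite /of_real; case: k => //= x y; rewrite rmorphD. Qed.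

Lemma of_realM : {morph @of_real R k : x y / x * y}.
Proof. by rewrite /of_real; case: k => //= x y; rewrite rmorphM. Qed.

Lemma of_real1 : of_real k 1 = 1 :> scalars R k.
Proof. by rewrite /of_real; case: k. Qed.

Lemma of_real0 : of_real k 0 = 0 :> scalars R k.
Proof. by rewrite /of_real; case: k. Qed.

Lemma ler_of_real (x y : R) : (of_real k x <= of_real k y) = (x <= y).
Proof. by rewrite /of_real; case: k => //=; rewrite lecR. Qed.

Lemma ltr_of_real (x y : R) : (of_real k x < of_real k y) = (x < y).
Proof. by rewrite /of_real; case: k => //=; rewrite ltcR. Qed.

Lemma norm_of_real (x : R) : `|of_real k x| = of_real k `|x|.
Proof.
have [x0|/ltW x0] := leP 0 x.
  by rewrite !ger0_norm// -of_real0 ler_of_real.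
rewrite !ler0_norm//; last by rewrite -of_real0 ler_of_real.
apply/eqP; rewrite eq_sym -subr_eq0 opprK -of_realD addNr.
by rewrite of_real0.
Qed.

End Scalars.

(** An alias of [X] carrying the restriction of scalars to [R], which keeps the two scalings
    apart. *)
Definition realify (R : realType) (k : scalar_kind)
  (X : lmodType (scalars R k)) : Type := X.

Section Realify.
Context (R : realType) (k : scalar_kind) (X : lmodType (scalars R k)).

HB.instance Definition _ := GRing.Zmodule.copy (realify X) X.

Definition real_scale (c : R) (x : realify X) : realify X :=
  of_real k c *: (x : X).

Lemma real_scaleA a b x : real_scale a (real_scale b x) = real_scale (a * b) x.
Proof. by rewrite /real_scale scalerA of_realM. Qed.

Lemma real_scale1 : left_id 1 real_scale.
Proof. by move=> x; rewrite /real_scale of_real1 scale1r. Qed.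

Lemma real_scaleDr : right_distributive real_scale +%R.
Proof. by move=> a x y; rewrite /real_scale scalerDr. Qed.

Lemma real_scaleDl x : {morph real_scale^~ x : a b / a + b}.
Proof. by move=> a b; rewrite /real_scale of_realD scalerDl. Qed.

HB.instance Definition _ := GRing.Zmodule_isLmodule.Build R (realify X)
  real_scaleA real_scale1 real_scaleDr real_scaleDl.

End Realify.

(** * Translation of the topology, the semigroups and the generators of X into real seminorms *)

Section LocallyConvex.
Context (R : realType) (k : scalar_kind) (X : tvsType (scalars R k)).
Context (Omega : Type) (p : Omega -> X -> scalars R k).
Hypothesis gen_p : generating_seminorms p.

Let V : lmodType R := realify X.

Definition real_seminorm a (x : realify X) : R := to_real (p a x).
Local Notation q := real_seminorm.

Lemma real_seminormE a (x : X) : p a x = of_real k (q a x).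
Proof. by rewrite to_realK//; have [+ _ _] := gen_p.1 a. Qed.

Lemma real_seminorm_lt a (x : X) (e : scalars R k) : 0 < e ->
  (p a x < e) = (q a x < to_real e).
Proof.
by move=> e0; rewrite real_seminormE -{1}(to_realK (ltW e0)) ltr_of_real.
Qed.

Lemma to_real_gt0 (e : scalars R k) : 0 < e -> 0 < to_real e.
Proof. by move=> e0; rewrite -(ltr_of_real k) of_real0 to_realK// ltW. Qed.

Lemma real_seminormP a : seminorm (q a : V -> R).
Proof.
have [_ pD pZ] := gen_p.1 a; split=> [x y|c x].
  by rewrite -(ler_of_real k) of_realD -!real_seminormE; exact: pD.
apply: (can_inj (@of_realK R k)).
by rewrite of_realM -norm_of_real -!real_seminormE; exact: pZ.
Qed.

(* Absolute values keep the coefficients nonnegative. *)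
Definition weighted_sum (s : seq (R * Omega)) (x : V) : R :=
  \sum_(c <- s) `|c.1| * q c.2 x.

Lemma weighted_sumP s : seminorm (weighted_sum s).
Proof.
split=> [x y|c x]; rewrite /weighted_sum.
  rewrite -big_split/=; apply: ler_sum => -[b a] _ /=.
  by rewrite -mulrDr ler_wpM2l// (seminormD (real_seminormP a)).
rewrite mulr_sumr; apply: eq_bigr => -[b a] _ /=.
by rewrite (seminormZ (real_seminormP a)) mulrCA.
Qed.

Definition dominating_seminorms : set (V -> R) := range weighted_sum.
Local Notation P := dominating_seminorms.

Lemma dominating_seminormP Q : P Q -> seminorm Q.
Proof. by move=> [s _ <-]; exact: weighted_sumP. Qed.

Lemma weighted_sum_cat s1 s2 x :
  weighted_sum (s1 ++ s2) x = weighted_sum s1 x + weighted_sum s2 x.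
Proof. by rewrite /weighted_sum big_cat. Qed.

Lemma dominating_directed Q1 Q2 : P Q1 -> P Q2 ->
  exists2 Q, P Q & forall x, Q1 x <= Q x /\ Q2 x <= Q x.
Proof.
move=> [s1 _ <-] [s2 _ <-].
exists (weighted_sum (s1 ++ s2)); first by exists (s1 ++ s2).
move=> x; rewrite weighted_sum_cat lerDl lerDr.
by split; apply: seminorm_ge0; exact: weighted_sumP.
Qed.

Lemma dominating_seminorm1 a : P (q a).
Proof.
exists [:: (1, a)] => //; apply/funext => x.
by rewrite /weighted_sum big_seq1/= normr1 mul1r.
Qed.

Lemma nbhs_real_seminorm a (x : X) (e : R) : 0 < e ->
  nbhs x [set y : X | q a (y - x) < e].
Proof.
move=> e0; apply/(gen_p.2 x _).2; exists 1%N, (fun=> a), (of_real k e).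
split; first by rewrite -of_real0 ltr_of_real.
by move=> y /(_ ord0); rewrite real_seminormE ltr_of_real.
Qed.

Lemma nbhs_dominating Q (x : X) (e : R) : P Q -> 0 < e ->
  nbhs x [set y : X | Q (y - x) <= e].
Proof.
move=> [s _ <-]; elim: s e => [|[b a] s IH] e e0.
  by apply: filterE => y; rewrite /= /weighted_sum big_nil ltW.
have e2 : 0 < e / 2 by rewrite divr_gt0.
(* Adding 1 keeps the divisor positive when the weight [b] vanishes. *)
have b0 : 0 < `|b| + 1 by rewrite ltr_wpDl.
have eb0 : 0 < e / 2 / (`|b| + 1) by rewrite divr_gt0.
apply: filterS2 (IH _ e2) (nbhs_real_seminorm a x eb0) => y /=.
rewrite ltr_pdivlMr// => sy ay.
rewrite /weighted_sum big_cons -/(weighted_sum s _)/=.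
have := seminorm_ge0 (real_seminormP a) (y - x).
by move: ay; rewrite mulrDr mulr1 [q a _ * _]mulrC; move: sy => /=; lra.
Qed.

Lemma real_seminorm_cvg (T : Type) (F : set_system T) (f : T -> X) (l : X) :
  Filter F -> (forall a e, 0 < e -> \forall t \near F, q a (f t - l) <= e) ->
  f @ F --> l.
Proof.
move=> FF fl U /(gen_p.2 l _).1[n [a [e [e0 eU]]]].
have e20 : 0 < to_real e / 2 by rewrite divr_gt0// to_real_gt0.
have : \forall t \near F, forall i : 'I_n, q (a i) (f t - l) <= to_real e / 2.
  by apply: filter_forall => i; exact: fl.
apply: filterS => t ft; apply: eU => i; rewrite real_seminorm_lt//.
by apply: le_lt_trans (ft i) _; rewrite gtr_pMr ?to_real_gt0// invf_lt1// ltr1n.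
Qed.

Lemma dominating_equicontinuous (G : set (X -> X)) Q :
  equicontinuous_family p G -> P Q ->
  exists2 Q', P Q' & forall g, G g -> forall x, Q (g x) <= Q' x.
Proof.
move=> eqG [s _ <-]; elim: s => [|[b a] s [_ [s' _ <-] IH]].
  exists (weighted_sum [::]); first by exists [::].
  by move=> g _ x; rewrite /weighted_sum !big_nil.
have [n [c [d [d0 Gc]]]] := eqG a.
(* The weight [b] multiplies the coefficients of the bound for the single seminorm [q a]. *)
pose sa := [seq (b * to_real (d i), c i) | i <- enum 'I_n].
exists (weighted_sum (sa ++ s')); first by exists (sa ++ s').
move=> g Gg x; rewrite weighted_sum_cat {1}/weighted_sum big_cons.
apply: lerD; last exact: IH.
rewrite /= /weighted_sum /sa big_map big_enum/=.
have /(_ g Gg x) := Gc; rewrite real_seminormE.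
rewrite (_ : \sum_(i < n) _ =
  of_real k (\sum_(i < n) to_real (d i) * q (c i) x)).
  rewrite ler_of_real => le_q; apply: le_trans (ler_wpM2l (normr_ge0 b) le_q) _.
  rewrite mulr_sumr; apply: ler_sum => i _.
  by rewrite normrM (ger0_norm (ltW (to_real_gt0 (d0 i)))) mulrA.
rewrite (big_morph (of_real k) (@of_realD R k) (of_real0 R k)).
by apply: eq_bigr => i _; rewrite of_realM to_realK ?ltW// -real_seminormE.
Qed.


Lemma EX_linear F h : EX p F -> 0 <= h -> linear (F h : V -> V).
Proof. by case=> + _ _ => /[apply] -[lin_F _] c x y; exact: lin_F. Qed.

Lemma EX_stable F s Q : EX p F -> P Q -> exists2 Q', P Q' &
  forall h n x, 0 <= h -> n%:R * h <= s -> Q (iter n (F h) x) <= Q' x.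
Proof.
move=> [_ F0 eqF] PQ; have [s0|s0] := leP 0 s; last first.
  exists Q => // h n x h0 /le_lt_trans/(_ s0).
  by rewrite ltNge mulr_ge0.
have [Q' PQ' QQ'] := dominating_equicontinuous (eqF s s0) PQ.
(* [power_family] contains only positive powers, so the zeroth one is obtained as [F 0 = id], with
   [d = 0]. *)
exists Q' => // h [|n] x h0 nh.
  apply: (QQ' id); exists 1%N, 1%N, 0; split=> //.
    by rewrite mulr0 mul0r.
  by rewrite mul0r /= F0.
apply: (QQ' (iter n.+1 (F h))); exists 1%N, n.+1, h.
by rewrite !divr1; split.
Qed.

Lemma lC0_semigroup_realify T :
  lC0_semigroup p T -> semigroup P (T : R -> V -> V).
Proof.
move=> [cont_T T0 TD EXT]; split=> //.
- by move=> s t x s0 t0; rewrite TD.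
- by move=> t; exact: EX_linear.
- move=> s Q PQ; have [Q' PQ' QQ'] := EX_stable s EXT PQ.
  by exists Q' => // t x t0 ts; apply: (QQ' t 1%N) => //; rewrite mul1r.
move=> Q e x PQ e0; rewrite near_withinE.
have : (T : R -> {ptws X -> X}) @ within `[0, +oo[ (nbhs (0 : R)) -->
    (T 0 : {ptws X -> X}).
  by move/subspace_continuousP : cont_T; apply; rewrite /= in_itv/= lexx.
move/pointwise_cvgP => /(_ x) Tx.
have := Tx _ (nbhs_dominating (T 0 x) PQ e0); rewrite T0/= => Txx.
have : \forall h \near within `[0, +oo[ (nbhs (0 : R)), Q (T h x - x) <= e.
  exact: Txx.
rewrite near_withinE; apply: filterS => h + h0; apply.
by rewrite /= in_itv/= andbT ltW.
Qed.

Lemma difference_quotientB T (x y : X) (h : R) : h != 0 ->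
  (T h x : V) - x - h *: (y : V) = h *: ((difference_quotient T x h : V) - y).
Proof.
move=> h0; rewrite scalerBr; congr (_ - _).
rewrite /difference_quotient.
(* Real scaling in [V] unfolds to scaling by [of_real k] in [X], so this equality holds by
   conversion. *)
transitivity (h *: (h^-1 *: ((T h x : V) - x))) => //.
by rewrite scalerA divff// scale1r.
Qed.

Lemma generator_derivative T C x : is_generator T C -> dom C x ->
  right_derivative P (T : R -> V -> V) x (C x).
Proof.
move=> [_ genC] /genC TC Q e PQ e0; have sQ := dominating_seminormP PQ.
have TCx := TC _ (nbhs_dominating (C x) PQ e0).
near=> h.
have h0 : 0 < h by near: h; exact: nbhs_right_gt.
rewrite difference_quotientB ?lt0r_neq0// (seminormZ_ge0 sQ) ?(ltW h0)// mulrC.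
by rewrite ler_wpM2r ?(ltW h0)//; near: h; exact: TCx.
Unshelve. all: by end_near. Qed.

(** The expansion makes the difference quotients converge to [y], which puts [x] in the domain;
    separation then identifies [y] with [C x]. *)
Lemma derivative_generator T C x y : hausdorff_space X -> is_generator T C ->
  right_derivative P (T : R -> V -> V) x y -> dom C x /\ C x = y.
Proof.
move=> hX [domC genC] dxy.
have Txy : difference_quotient T x @ 0^'+ --> y.
  apply: real_seminorm_cvg => a e e0; near=> h.
  have h0 : 0 < h by near: h; exact: nbhs_right_gt.
  rewrite -(ler_pM2l h0) -(seminormZ_ge0 (real_seminormP a) _ (ltW h0)).
  rewrite -difference_quotientB ?lt0r_neq0// [h * e]mulrC.
  by near: h; apply: dxy => //; exact: dominating_seminorm1.
have Cx : dom C x by rewrite domC; exists y.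
by split=> //; apply: (cvg_unique hX (genC x Cx) Txy).
Unshelve. all: by end_near. Qed.

Lemma sequentially_complete_realify (u : nat -> V) : sequentially_complete p ->
  (forall Q e, P Q -> 0 < e -> exists N : nat, forall m n,
    (N <= m)%N -> (N <= n)%N -> Q (u m - u n) <= e) ->
  exists l, forall Q e, P Q -> 0 < e ->
    exists N : nat, forall n, (N <= n)%N -> Q (u n - l) <= e.
Proof.
move=> complete cauchy_u; have [|l ul] := complete u.
  move=> a e e0; have e20 : 0 < to_real e / 2 by rewrite divr_gt0// to_real_gt0.
  have [N uN] := cauchy_u _ _ (dominating_seminorm1 a) e20.
  exists N => m n Nm Nn; rewrite real_seminorm_lt//.
  apply: le_lt_trans (uN m n Nm Nn) _.
  by rewrite gtr_pMr ?to_real_gt0// invf_lt1// ltr1n.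
exists l => Q e PQ e0; have [N _ uN] := ul _ (nbhs_dominating l PQ e0).
by exists N => n; exact: uN.
Qed.

Lemma core_approx C D x Q e : core C D -> dom C x -> P Q -> 0 < e ->
  exists2 d, D d & Q (d - x : V) <= e /\ Q (C d - C x : V) <= e.
Proof.
move=> [_ clD] Cx PQ e0.
have : graph C (x, C x) by exists x.
pose U z := [set y : X | Q (y - z : V) <= e].
rewrite -clD => /(_ (U x `*` U (C x)))[].
  by exists (U x, U (C x)) => //; split; exact: nbhs_dominating.
by move=> _ [[d Dd <-] [/= ? ?]]; exists d.
Qed.

End LocallyConvex.

Theorem theorem6p3 (R : realType) (k : scalar_kind) (X : tvsType (scalars R k))
    (Omega : Type) (p : Omega -> X -> scalars R k)
    (A B Z : operator X) (expA expB expZ : R -> X -> X) (D : set X) :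
  hausdorff_space X ->
  generating_seminorms p ->
  sequentially_complete p ->
  generates p expA A ->
  generates p expB B ->
  generates p expZ Z ->
  core Z D ->
  D `<=` dom A `&` dom B ->
  (forall f, D f -> Z f = A f + B f) ->
  EX p (fun s => expA s \o expB s) ->
  forall (f : X) (t0 : R), 0 < t0 ->
    uniform_cvg_on p `[0, t0]
      (fun n t => iter n (expA (t / n%:R) \o expB (t / n%:R)) f)
      (fun t => expZ t f).
Proof.
move=> hX gen_p complete [sA gA] [sB gB] [sZ gZ] coreD DAB.
move=> ZAB EXF f t0 t00 a e e0.
pose P := dominating_seminorms p.
have P_seminorm Q (PQ : P Q) : seminorm Q := dominating_seminormP gen_p PQ.
have P_directed := dominating_directed gen_p.
have sA' := lC0_semigroup_realify gen_p sA.
have sZ' := lC0_semigroup_realify gen_p sZ.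
pose V : lmodType R := realify X.
pose F : R -> V -> V := fun s => expA s \o expB s.
have F0 : F 0 = id by case: EXF.
have F_linear h : 0 <= h -> linear (F h) by exact: (EX_linear EXF).
have F_stable s Q : P Q -> exists2 Q', P Q' &
    forall h n x, 0 <= h -> n%:R * h <= s -> Q (iter n (F h) x) <= Q' x.
  by move=> PQ; exact: (EX_stable gen_p s EXF PQ).
have F_derivative d z : D d /\ z = Z d -> right_derivative P F d z.
  move=> [Dd ->]; have [Ad Bd] := DAB _ Dd; rewrite ZAB//.
  apply: right_derivative_comp => //; exact: generator_derivative.
have D_core x y : right_derivative P (expZ : R -> V -> V) x y ->
    forall Q e, P Q -> 0 < e ->
    exists d z, [/\ D d /\ z = Z d, Q (d - x : V) <= e & Q (z - y : V) <= e].
  move=> /(derivative_generator gen_p hX gZ)[Zx <-] Q e' PQ e'0.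
  have [d Dd [dx zx]] := core_approx gen_p coreD Zx PQ e'0.
  by exists d, (Z d).
have dense x Q e' : P Q -> 0 < e' ->
    exists w y,
      right_derivative P (expZ : R -> V -> V) w y /\ Q (w - x : V) <= e'.
  apply: right_derivative_dense => // u.
  exact: sequentially_complete_realify.
have e20 : 0 < to_real e / 2 by rewrite divr_gt0// to_real_gt0.
have Pa := dominating_seminorm1 p a.
have := chernoff_dense (D := fun d z => D d /\ z = Z d) P_seminorm P_directed
  sZ' F_linear F_stable F_derivative D_core dense Pa t00 e20 f.
have e2e : to_real e / 2 < to_real e.
  by rewrite gtr_pMr ?to_real_gt0// invf_lt1// ltr1n.
(* The step h = 0 must be included, since t = 0 belongs to the interval. *)
move=> /near0_itv[].
  move=> n _; rewrite mulr0 (semigroup0 sZ').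
  have -> : iter n (F 0) f = f.
    by elim: n => // n IH; rewrite iterS IH F0.
  by rewrite subrr (seminorm0 (P_seminorm _ Pa)) ltW.
(* Uniformity in [t]: the steps [t / n] are all at most [t0 / n <= r], with [N] depending on [t0]
   and [r] only. *)
move=> r r0 cvgF; have [N [N0 tN]] := near_inv_nat t0 r0.
exists N => n Nn t; rewrite /= in_itv/= => /andP[t_ge0 tt0].
have n0 : 0 < n%:R :> R by rewrite ltr0n (leq_trans N0).
rewrite real_seminorm_lt//; apply: le_lt_trans e2e.
have tE : n%:R * (t / n%:R) = t by rewrite mulrC divfK// lt0r_neq0.
have tn0 : 0 <= t / n%:R by rewrite divr_ge0// ltW.
have tnr : t / n%:R <= r.
  by apply: le_trans (tN _ Nn); rewrite ler_wpM2r// invr_ge0 ltW.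
by have := cvgF _ tn0 tnr n; rewrite tE; apply.
Qed.
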